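(* Let $N\ge2$ be an odd integer, and let $P^{odd}_{\max}$ denote the (unique) polynomial in $\mathcal T_N$ whose coefficient $a_2$ is maximal among all polynomials in $\mathcal T_N$. Then $$P^{odd}_{\max}(z)=\frac z{1-2z\cos\frac{2\pi}{N+3}+z^2}+\frac4{N+3}\cdot\sin^2\frac{2\pi}{N+3}\cdot\frac{z^3}{1-z^2}\cdot\frac{1-z^{N+3}}{\left(1-2z\cos\frac{2\pi}{N+3}+z^2\right)^2}.$$ Hence the resulting non-negative trigonometric polynomial (for $t\in(0,\pi)$) has the form $$\mathrm{Im}\left(P^{odd}_{\max}(e^{it})\right)=\frac{\sin^2\frac{2\pi}{N+3}}{N+3}\cdot\frac1{\sin t}\cdot\frac{\sin^2\frac{N+3}2t}{\left(\cos t-\cos\frac{2\pi}{N+3}\right)^2}.$$ For the problem of minimizing $a_2$ over $\mathcal T_N$, the extremizer is obtained from the maximum extremizer by changing the signs of the coefficients of even powers, i.e. $P^{odd}_{\min}(z)=-P^{odd}_{\max}(-z)$.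
   Context: $\mathbb D=\{z\in\mathbb C:|z|<1\}$. A holomorphic function $F:\mathbb D\to\mathbb C$ is typically real if $F(z)\in\mathbb R$ for all $z\in\mathbb R\cap\mathbb D$ and $\mathrm{Im}\{F(z)\}\cdot\mathrm{Im}\{z\}>0$ for all $z\in\mathbb D\setminus\mathbb R$. $\mathcal T_N$ is the set of typically real polynomials of the form $P(z)=z+\sum_{j=2}^Na_jz^j$ with $a_j\in\mathbb R$. $P^{odd}_{\min}$ denotes the (unique) polynomial in $\mathcal T_N$ with minimal $a_2$. The right-hand sides are understood after removal of removable singularities. *)

(* Defs.v *)
From mathcomp Require Import all_boot all_order all_algebra.
From mathcomp Require Import all_classical all_reals all_analysis.
From mathcomp Require Import complex.

Set Implicit Arguments.
Unset Strict Implicit.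
Unset Printing Implicit Defensive.

Import Order.TTheory GRing.Theory Num.Theory.
Import numFieldNormedType.Exports.

Local Open Scope classical_set_scope.
Local Open Scope ring_scope.

Definition holomorphic_on (K : numFieldType) (D : set K) (F : K -> K) : Prop :=
  forall z, D z -> derivable F z 1.

(* Division is total, so the singular points S of the formula g have to be
   listed: F equals g off S, and at a point of S the formula has a limit,
   namely the value of F. *)
Definition eq_mod_removable (K : numFieldType) (D S : set K) (F g : K -> K) :
    Prop :=
  (forall z, D z -> ~ S z -> F z = g z) /\
  (forall z, D z -> S z -> g w @[w --> z^'] --> F z).

Section TypicallyReal.
Variable R : realType.
Local Notation C := R[i].

Definition unit_disk : set C := [set z | `|z| < 1].

Definition typically_real (F : C -> C) : Prop :=
  [/\ holomorphic_on unit_disk F,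
      forall z, unit_disk z -> z \is Num.real -> F z \is Num.real &
      forall z, unit_disk z -> z \isn't Num.real ->
        0 < complex.Im (F z) * complex.Im z].

Definition ceval (P : {poly R}) (z : C) : C := (map_poly (real_complex R) P).[z].

Definition typically_real_polys (N : nat) : set {poly R} :=
  [set P : {poly R} | [/\ (size P <= N.+1)%N, P`_0 = 0, P`_1 = 1 &
               typically_real (ceval P)]].

Definition maximizes_a2 (N : nat) (P : {poly R}) : Prop :=
  typically_real_polys N P /\
  forall Q, typically_real_polys N Q -> Q`_2 <= P`_2.

Definition minimizes_a2 (N : nat) (P : {poly R}) : Prop :=
  typically_real_polys N P /\
  forall Q, typically_real_polys N Q -> P`_2 <= Q`_2.

Definition cis (t : R) : C := (cos t +i* sin t)%C.

End TypicallyReal.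

(* Main.v *)
Require Import Defs.
From mathcomp Require Import all_boot all_order all_algebra.
From mathcomp Require Import all_classical all_reals all_analysis.
From mathcomp Require Import complex polyrcf.
From mathcomp Require Import ring lra zify.

Set Implicit Arguments.
Unset Strict Implicit.
Unset Printing Implicit Defensive.

Import Order.TTheory GRing.Theory Num.Theory.
Import numFieldNormedType.Exports.
Import ComplexField.Normc.

Local Open Scope classical_set_scope.
Local Open Scope ring_scope.
Local Open Scope complex_scope.

(** Put [M = N + 3 = 2n] and [theta = 2 pi / M = pi / n].  For a polynomial [P]
    with real coefficients [a_j], [Im P(e^(it))] is the sine polynomial
    [T(t) = sum_j a_j sin (jt)].  If [P] is typically real then [T >= 0] on
    [(0, pi)], by letting [r] tend to 1 in [Im P(r e^(it))]; conversely [T >= 0]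
    and [a_1 = 1] imply that [P] is typically real, by a minimum principle
    ([Im_ceval_gt0]).  So the question concerns nonnegative sine polynomials of
    degree at most [N] with [a_1 = 1] ([typically_real_polysP]).

    The bound on [a_2] is a Gaussian quadrature.  On the grid [t_k = k theta],
    sines of frequencies [j] and [l] are orthogonal as long as [j + l < 2n], which
    for [j <= N] holds exactly up to [l = 2].  Therefore [a_1] and [a_2] are [2/n]
    times the sums of [T(t_k) sin t_k] and [T(t_k) sin (2 t_k)].  As
    [sin (2t) = 2 cos t sin t], [a_2] is an average of the numbers [2 cos t_k],
    [1 <= k < n], so [a_2 <= 2 cos theta] ([a2_le]).  In the case of equality [T]
    vanishes at [t_2, ..., t_(n-1)], to order two since it is nonnegative; as
    [T(t) / sin t] is a polynomial in [cos t] of degree at most [2(n - 2)], these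
    zeros determine it up to a factor, and [a_1 = 1] fixes the factor
    ([a2_max_unique]).

    A maximizer is given by explicit coefficients.  With
    [q = 1 - 2 z cos theta + z^2], multiplication by [q] is the second difference
    [a_(j+2) - 2 cos theta a_(j+1) + a_j] on coefficients; applied twice to
    [extremal_coef] it leaves a constant on the odd indices, and the generating
    sums give [q^2 (1 - z^2) P = z q (1 - z^2) + kappa z^3 (1 - z^M)]
    ([ceval_extremal_poly]).  This is the closed form, and on the unit circle its
    imaginary part is the squared expression ([Im_extremal_poly]), so that
    [T >= 0] and [P] is admissible, with [a_2 = 2 cos theta].  At a removable
    singularity the value is the limit because [P] and [T] are continuous and the
    singularities are isolated.

    Finally [P |-> - P(-z)] preserves typically real polynomials and negates
    [a_2], which carries everything over to the minimum. *)

(** * Boundary values as sine polynomials *)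

Lemma ImD (R : realType) (z w : R[i]) :
  complex.Im (z + w) = complex.Im z + complex.Im w.
Proof. by case: z => a b; case: w. Qed.

Lemma Im_sum (R : realType) (I : Type) (r : seq I) (P : pred I) (F : I -> R[i]) :
  complex.Im (\sum_(i <- r | P i) F i) = \sum_(i <- r | P i) complex.Im (F i).
Proof. by apply: (big_morph (@complex.Im R)) => // z w; rewrite ImD. Qed.

Lemma Im_scale (R : realType) (a : R) (z : R[i]) :
  complex.Im (a%:C * z) = a * complex.Im z.
Proof. by case: z => x y /=; rewrite mul0r addr0. Qed.

Lemma cisX (R : realType) (t : R) (j : nat) : cis t ^+ j = cis (j%:R * t).
Proof.
elim: j => [|j IH]; first by rewrite mul0r /cis cos0 sin0.
rewrite exprS IH -natr1 mulrDl mul1r addrC /cis cosD sinD.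
apply/eqP; rewrite eq_complex /= addrC [X in _ == X]addrC.
by apply/andP; split; apply/eqP; ring.
Qed.

Lemma ceval_wide (R : realType) (P : {poly R}) (n : nat) (z : R[i]) :
  (size P <= n)%N -> ceval P z = \sum_(j < n) (P`_j)%:C * z ^+ j.
Proof.
move=> sP; rewrite /ceval (@horner_coef_wide _ n).
  by apply: eq_bigr => j _; rewrite coef_map.
by rewrite size_map_poly.
Qed.

Lemma Im_ceval_cis (R : realType) (P : {poly R}) (n : nat) (t : R) :
  (size P <= n)%N ->
  complex.Im (ceval P (cis t)) = \sum_(j < n) P`_j * sin (j%:R * t).
Proof.
move=> sP; rewrite (ceval_wide _ sP) Im_sum; apply: eq_bigr => j _.
by rewrite Im_scale cisX.
Qed.

(** * Quadrature on an equally spaced grid *)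

Lemma cos_sum_telescope (R : realType) (a : R) (n : nat) :
  (0 < n)%N ->
  2 * sin (a / 2) * (\sum_(k < n) cos (k%:R * a)) =
    sin ((n%:R - 1 / 2) * a) + sin (a / 2).
Proof.
case: n => // n _; elim: n => [|n IH].
  rewrite big_ord1 mul0r cos0.
  rewrite (_ : (1 - 1 / 2) * a = a / 2); last by field.
  by ring.
rewrite big_ord_recr /= mulrDr IH.
rewrite (_ : (n.+2%:R - 1 / 2) * a = n.+1%:R * a + a / 2); last by rewrite -natr1; field.
rewrite (_ : (n.+1%:R - 1 / 2) * a = n.+1%:R * a - a / 2); last by field.
by rewrite sinB sinD; ring.
Qed.

Lemma sin_natr_pi (R : realType) (m : nat) : sin (m%:R * pi : R) = 0.
Proof.
elim: m => [|m IH]; first by rewrite mul0r sin0.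
by rewrite -natr1 mulrDl mul1r sinDpi IH oppr0.
Qed.

Lemma cos_natr_pi (R : realType) (m : nat) : cos (m%:R * pi : R) = (-1) ^+ m.
Proof.
elim: m => [|m IH]; first by rewrite mul0r cos0.
by rewrite -natr1 mulrDl mul1r cosDpi IH exprS mulN1r.
Qed.

(** Dirichlet's closed form at [a = m pi / n]: since [n a] is a multiple of
    [pi], only the parity of [m] survives. *)
Lemma cos_sum_grid (R : realType) (m n : nat) : (0 < m < 2 * n)%N ->
  \sum_(k < n) cos (k%:R * (m%:R * pi / n%:R) : R) = (odd m)%:R.
Proof.
move=> /andP[m0 mn]; have n0 : (0 < n)%N by lia.
have n0R : n%:R != 0 :> R by rewrite pnatr_eq0; lia.
set a : R := m%:R * pi / n%:R.
have sa : 0 < sin (a / 2).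
  apply: sin_gt0_pi; rewrite /a; apply/andP; split.
    by rewrite !divr_gt0 ?mulr_gt0 ?pi_gt0 ?ltr0n.
  rewrite -mulrA -invfM ltr_pdivrMr ?mulr_gt0 ?ltr0n//.
  rewrite mulrC ltr_pM2l ?pi_gt0// -natrM ltr_nat; lia.
have := cos_sum_telescope a n0.
rewrite (_ : (n%:R - 1 / 2) * a = m%:R * pi - a / 2); last by rewrite /a; field.
rewrite sinB sin_natr_pi cos_natr_pi mul0r sub0r -signr_odd => h.
apply: (mulfI (lt0r_neq0 sa)); apply: (mulfI (_ : 2 != 0 :> R)) => //.
rewrite mulrA h; case: (odd m); rewrite /= ?expr1 ?expr0; ring.
Qed.

(** The product of sines is half a difference of cosines of frequencies
    [j - l] and [j + l], which have the same parity and so cancel.  The condition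
    [j + l < 2n] excludes aliasing; it allows a high frequency to be tested
    against a low one, which a bound on each of them separately would not. *)
Lemma sin_grid_orthogonal (R : realType) (n j l : nat) :
  (0 < j)%N -> (0 < l)%N -> (j + l < 2 * n)%N ->
  \sum_(k < n) sin (j%:R * (k%:R * (pi / n%:R))) * sin (l%:R * (k%:R * (pi / n%:R)))
    = if j == l then n%:R / 2 else 0 :> R.
Proof.
wlog jl : j l / (l <= j)%N.
  move=> W j0 l0 jln; case: (leqP l j) => h; first exact: W.
  rewrite eq_sym -(W l j) // 1?addnC//; last exact: ltnW.
  by apply: eq_bigr => k _; rewrite mulrC.
move=> j0 l0 jln.
have n0R : n%:R != 0 :> R by rewrite pnatr_eq0; lia.
have E (k : 'I_n) : sin (j%:R * (k%:R * (pi / n%:R))) * sin (l%:R * (k%:R * (pi / n%:R))) =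
   1 / 2 * (cos (k%:R * ((j - l)%:R * pi / n%:R)) -
    cos (k%:R * ((j + l)%:R * pi / n%:R))) :> R.
  rewrite natrD natrB//.
  rewrite (_ : k%:R * ((j%:R - l%:R) * pi / n%:R) =
     j%:R * (k%:R * (pi / n%:R)) - l%:R * (k%:R * (pi / n%:R))); last by field.
  rewrite (_ : k%:R * ((j%:R + l%:R) * pi / n%:R) =
     j%:R * (k%:R * (pi / n%:R)) + l%:R * (k%:R * (pi / n%:R))); last by field.
  by rewrite cosB cosD; field.
rewrite (eq_bigr _ (fun k _ => E k)) -mulr_sumr sumrB.
rewrite (@cos_sum_grid _ (j + l)); last by lia.
case: eqP => [->|/eqP njl].
  rewrite subnn (eq_bigr (fun=> 1)); last by move=> k _; rewrite mul0r mul0r mulr0 cos0.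
  by rewrite sumr_const card_ord addnn odd_double /=; field.
rewrite cos_sum_grid; last by lia.
by rewrite oddB// oddD subrr mulr0.
Qed.

(** Quadrature for sine coefficients.  It is used with a large [n] and all [l]
    for positivity in the disc, and with the smallest possible [n], namely
    [N + 3 = 2n] and [l = 1, 2], for the extremal problem. *)
Lemma coef_of_grid_values (R : realType) (P : {poly R}) (N n l : nat) :
  (size P <= N.+1)%N -> (0 < l)%N -> (N + l < 2 * n)%N ->
  \sum_(k < n) complex.Im (ceval P (cis (k%:R * (pi / n%:R))))
    * sin (l%:R * (k%:R * (pi / n%:R))) = n%:R / 2 * P`_l.
Proof.
move=> sP l0 Nln.
under eq_bigr => k _ do rewrite (Im_ceval_cis _ sP) mulr_suml.
rewrite exchange_big /=.
transitivity (\sum_(j < N.+1) P`_j * (if j == l :> nat then n%:R / 2 else 0)).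
  apply: eq_bigr => j _.
  under eq_bigr => k _ do rewrite -mulrA.
  rewrite -mulr_sumr; congr (_ * _).
  case: (posnP j) => [->|j0].
    rewrite (ltn_eqF l0) big1// => k _; by rewrite mul0r sin0 mul0r.
  by rewrite sin_grid_orthogonal//; have := ltn_ord j; lia.
case: (leqP l N) => h.
  rewrite (bigD1 (inord l)) //= big1 ?addr0 ?inordK ?eqxx 1?mulrC//.
  move=> i /negP il; case: eqP => [e|]; rewrite ?mulr0//.
  by case: il; apply/eqP/val_inj; rewrite /= inordK.
rewrite nth_default ?mulr0 ?(leq_trans sP)// big1// => j _.
case: eqP => [e|]; rewrite ?mulr0//.
by have := ltn_ord j; lia.
Qed.

Lemma grid_itv (R : realType) (n k : nat) : (0 < k < n)%N ->
  0 < k%:R * (pi / n%:R : R) < pi.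
Proof.
move=> /andP[k0 kn]; have n0 : (0 < n)%N by lia.
have n0R : 0 < n%:R :> R by rewrite ltr0n.
rewrite mulr_gt0 ?divr_gt0 ?pi_gt0 ?ltr0n//=.
by rewrite mulrCA gtr_pMr ?pi_gt0// ltr_pdivrMr// mul1r ltr_nat.
Qed.

Lemma cos_grid_lt (R : realType) (n j k : nat) : (j < k <= n)%N ->
  cos (k%:R * (pi / n%:R)) < cos (j%:R * (pi / n%:R) : R).
Proof.
move=> /andP[jk kn]; have n0 : (0 < n)%N by lia.
have n0R : 0 < n%:R :> R by rewrite ltr0n.
have itv (i : nat) : (i <= n)%N -> i%:R * (pi / n%:R) \in `[0, pi :> R].
  move=> ik; rewrite in_itv /= mulr_ge0 ?divr_ge0 ?pi_ge0//=.
  by rewrite mulrCA ler_piMr ?pi_ge0// ler_pdivrMr// mul1r ler_nat.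
rewrite ltr_cos ?itv// 1?ltnW ?(leq_trans jk)//.
by rewrite ltr_pM2r ?divr_gt0 ?pi_gt0// ltr_nat.
Qed.

(** * Positivity in the upper half disc *)

(** Multiplication by [1 - 2cz + z^2] acts on generating sums as the second
    difference [u_(j+2) - 2c u_(j+1) + u_j] on coefficients.  With [c = cos t]
    that operator annihilates [sin (jt)] and [cos (jt)], which is what sums both
    the kernel of the disc and the extremal polynomial. *)
Lemma second_difference_sum (K : comNzRingType) (c z : K) (u : nat -> K) (n : nat) :
  (1 - 2 * z * c + z ^+ 2) * (\sum_(j < n) u j * z ^+ j) =
    u 0%N + (u 1%N - 2 * c * u 0%N) * z
    + z ^+ 2 * (\sum_(j < n) (u j.+2 - 2 * c * u j.+1 + u j) * z ^+ j)
    - u n * z ^+ n - (u n.+1 - 2 * c * u n) * z ^+ n.+1.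
Proof.
elim: n => [|n IH]; first by rewrite !big_ord0 expr0 expr1; ring.
rewrite !big_ord_recr /= mulrDr IH mulrDr.
by rewrite !exprS; ring.
Qed.

Lemma sin_natmul_bound (R : realType) (t : R) (k : nat) :
  0 <= t <= pi -> `|sin (k%:R * t)| <= k%:R * sin t.
Proof.
move=> /sin_ge0_pi s0; elim: k => [|k IH]; first by rewrite !mul0r sin0 normr0.
rewrite -natr1 !mulrDl !mul1r sinD.
apply: (le_trans (ler_normD _ _)); rewrite !normrM; apply: lerD.
  by apply: le_trans IH; rewrite ler_piMr// cos_max.
by rewrite (ger0_norm s0) ler_piMl// cos_max.
Qed.

(** With [p = sqrt r], Bernoulli's inequality bounds [K p^K] by [1 / (1 - p)],
    and the remaining factor [p^K] tends to 0. *)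
Lemma natmul_expr_small (R : realType) (r e : R) (N : nat) :
  0 <= r < 1 -> 0 < e -> exists2 K, (N <= K)%N & K%:R * r ^+ K < e.
Proof.
move=> /andP[r0 r1] e0; set p := Num.sqrt r.
have p0 : 0 <= p by rewrite sqrtr_ge0.
have p1 : p < 1 by rewrite -sqrtr1 ltr_sqrt.
have rE : r = p ^+ 2 by rewrite sqr_sqrtr.
(* the form of Bernoulli's inequality that is stable under induction on n *)
have bernoulli (n : nat) : n%:R * p ^+ n * (1 - p) + p ^+ n <= 1.
  elim: n => [|n IH]; first by rewrite !mul0r add0r expr0.
  have pn1 : p ^+ n <= 1 by rewrite exprn_ile1// ltW.
  have pn0 : 0 <= p ^+ n by rewrite exprn_ge0.
  rewrite exprS -natr1; set X := p ^+ n in IH pn0 pn1 *.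
  apply: (@le_trans _ _ (p * (1 + (1 - p)))).
    rewrite (_ : (n%:R + 1) * (p * X) * (1 - p) + p * X =
       p * (n%:R * X * (1 - p) + X + X * (1 - p))); last by ring.
    rewrite ler_wpM2l// lerD// ler_piMl//; lra.
  by rewrite -subr_ge0 (_ : 1 - _ = (1 - p) ^+ 2) ?sqr_ge0//; ring.
have : (fun n => p ^+ n) @ \oo --> (0 : R) by apply: cvg_expr; rewrite ger0_norm.
move=> /cvgr0Pnorm_lt /(_ (e * (1 - p))); rewrite mulr_gt0 ?subr_gt0// => /(_ isT).
move=> [M _ hM]; exists (maxn M N); first exact: leq_maxr.
set K := maxn M N.
have := hM K (leq_maxl _ _); rewrite /= ger0_norm ?exprn_ge0// => hK.
have pK0 : 0 <= p ^+ K by rewrite exprn_ge0.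
have p1' : 0 < 1 - p by rewrite subr_gt0.
rewrite -(ltr_pM2r p1'); apply: le_lt_trans hK.
rewrite rE -exprM mulnC exprM expr2.
rewrite (_ : _ * (1 - p) = K%:R * p ^+ K * (1 - p) * p ^+ K); last by ring.
rewrite ler_piMl//; have := bernoulli K; lra.
Qed.

Lemma Im_ge_Nnormc (R : realType) (z : R[i]) : - normc z <= complex.Im z.
Proof.
case: z => x y /=; rewrite lerNl.
apply: le_trans (ler_norm (- y)) _; rewrite normrN -sqrtr_sqr ler_wsqrtr//.
by rewrite lerDr sqr_ge0.
Qed.

Lemma normc_real (R : realType) (a : R) : normc (a%:C) = `|a|.
Proof. by rewrite /= expr0n addr0 sqrtr_sqr. Qed.

Lemma normcX (R : realType) (z : R[i]) (n : nat) : normc (z ^+ n) = normc z ^+ n.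
Proof.
elim: n => [|n IH]; first by rewrite !expr0 normc1.
by rewrite !exprS normcM IH.
Qed.

Lemma normc_ge0 (R : realType) (z : R[i]) : 0 <= normc z.
Proof. by case: z => x y; rewrite sqrtr_ge0. Qed.

(** The full series [sum_j sin (jt) z^j] equals [sin t * z / q] with
    [q = 1 - 2 z cos t + z^2], and [Im z / q] is [Im z (1 - |z|^2) / |q|^2], which
    is positive.  Truncation costs at most [2 (K + 1) |z|^(K + 1) sin t / |q|]
    because [|sin (kt)| <= k sin t]; this error is proportional to [sin t] too,
    hence one [K] serves all [t].  The comparison is made after multiplication by
    [|q|^2], where the bound [|q| <= 4] suffices. *)
Lemma truncated_kernel_gt0 (R : realType) (z : R[i]) (t : R) (K : nat) :
  0 < complex.Im z -> normc z < 1 -> 0 < t < pi ->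
  8 * (K.+1%:R * normc z ^+ K.+1) < complex.Im z * (1 - normc z ^+ 2) ->
  0 < complex.Im (\sum_(j < K.+1) (sin (j%:R * t))%:C * z ^+ j).
Proof.
move=> y0 r1 t0pi hK; set H := \sum_(j < _) _.
have s0 : 0 < sin t by apply: sin_gt0_pi.
have tpi : 0 <= t <= pi by move: t0pi => /andP[/ltW -> /ltW ->].
pose u j := (sin (j%:R * t))%:C : R[i].
pose q := 1 - 2 * z * (cos t)%:C + z ^+ 2.
pose tail := u K * z ^+ K.+2 - u K.+1 * z ^+ K.+1.
have rec j : u j.+2 - 2 * (cos t)%:C * u j.+1 + u j = 0.
  rewrite /u -[j.+2%:R]natr1 -[j.+1%:R]natr1 mulrDl mul1r sinD.
  set a := (j%:R + 1) * t.
  rewrite (_ : j%:R * t = a - t) ?sinB; last by rewrite /a; ring.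
  by apply/eqP; rewrite eq_complex /=; apply/andP; split; apply/eqP; ring.
have qH : q * H = (sin t)%:C * z + tail.
  rewrite /q (second_difference_sum (cos t)%:C z u).
  rewrite [X in _ ^+ 2 * X]big1 => [|j _]; last by rewrite rec mul0r.
  have -> : u K.+2 - 2 * (cos t)%:C * u K.+1 = - u K.
    by apply/eqP; rewrite -subr_eq0 opprK rec.
  by rewrite /tail /u mul0r sin0 mul1r mulr0 mulr0 subr0 add0r addr0; ring.
set r := normc z in r1 hK *.
have r0 : 0 <= r by apply: normc_ge0.
have nq : normc q <= 4.
  rewrite /q; apply: (le_trans (le_normcD _ _)).
  have : normc (1 - 2 * z * (cos t)%:C) <= 3.
    apply: (le_trans (le_normcD _ _)); rewrite normcN !normcM normc1 normc_real.
    rewrite -/r (_ : normc 2 = 2); last first.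
      by rewrite -(rmorph_nat (real_complex R) 2) normc_real ger0_norm.
    have := cos_max t; have := normr_ge0 (cos t); nra.
  rewrite normcX -/r; have : r ^+ 2 <= 1 by rewrite exprn_ile1// ltW.
  lra.
have nt : normc tail <= sin t * (2 * K.+1%:R * r ^+ K.+1).
  have rK0 : 0 <= r ^+ K.+1 by rewrite exprn_ge0.
  rewrite /tail; apply: (le_trans (le_normcD _ _)); rewrite normcN !normcM !normcX !normc_real -/r.
  have h1 := sin_natmul_bound K.+1 tpi; have h2 := sin_natmul_bound K tpi.
  have h3 : `|sin (K%:R * t)| <= K.+1%:R * sin t.
    by apply: (le_trans h2); rewrite (ler_wpM2r (ltW s0))// ler_nat.
  have h4 : r ^+ K.+2 <= r ^+ K.+1 by rewrite [_ ^+ K.+2]exprS ler_piMl// ltW.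
  rewrite (_ : sin t * _ = K.+1%:R * sin t * r ^+ K.+1 + K.+1%:R * sin t * r ^+ K.+1); last by ring.
  have r2 : 0 <= r ^+ K.+2 by rewrite exprn_ge0.
  by apply: lerD; apply: ler_pM.
have nJ : normc (q^*) = normc q by case: (q) => a b /=; rewrite sqrrN.
(* the left factor is |q|^2: this is the imaginary part of q^* q H *)
have E : (complex.Re q ^+ 2 + complex.Im q ^+ 2) * complex.Im H =
    sin t * (complex.Im z * (1 - r ^+ 2)) + complex.Im (q^* * tail).
  have -> : r ^+ 2 = complex.Re z ^+ 2 + complex.Im z ^+ 2.
    rewrite /r; case: (z) => x y /=; rewrite sqr_sqrtr// addr_ge0// ?sqr_ge0//.
  transitivity (complex.Im (q^* * (q * H))).
    by case: (q) (H) => a b [x y] /=; ring.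
  rewrite qH mulrDr ImD; congr (_ + _).
  by rewrite /q expr2; case: (z) => x y /=; ring.
have lb : - (sin t * (8 * (K.+1%:R * r ^+ K.+1))) <= complex.Im (q^* * tail).
  apply: le_trans (Im_ge_Nnormc _); rewrite lerN2 normcM nJ.
  rewrite (_ : sin t * _ = 4 * (sin t * (2 * K.+1%:R * r ^+ K.+1))); last by ring.
  by rewrite ler_pM// normc_ge0.
have pos : 0 < (complex.Re q ^+ 2 + complex.Im q ^+ 2) * complex.Im H.
  rewrite E; apply: (@lt_le_trans _ _ (sin t * (complex.Im z * (1 - r ^+ 2))
    - sin t * (8 * (K.+1%:R * r ^+ K.+1)))); last by rewrite lerD2l.
  by rewrite -mulrBr mulr_gt0// subr_gt0.
have q0 : 0 <= complex.Re q ^+ 2 + complex.Im q ^+ 2 by rewrite addr_ge0 ?sqr_ge0.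
rewrite ltNge; apply: contraTN pos => H0.
by rewrite -leNgt mulr_ge0_le0.
Qed.

(** Minimum principle, by quadrature: the coefficients of [P] are averages of
    its boundary values against [sin (l t_k)], so [Im P(z)] is the average of these
    values against the truncated kernel, which is positive once the grid is fine
    enough for [z].  Strictness comes from [P`_1 = 1]: the boundary values cannot
    vanish on the whole grid. *)
Lemma Im_ceval_gt0 (R : realType) (P : {poly R}) (z : R[i]) :
  P`_1 = 1 ->
  (forall t : R, 0 < t < pi -> 0 <= complex.Im (ceval P (cis t))) ->
  normc z < 1 -> 0 < complex.Im z -> 0 < complex.Im (ceval P z).
Proof.
move=> P1 T0 r1 y0.
have e0 : 0 < complex.Im z * (1 - normc z ^+ 2) / 8.
  by rewrite divr_gt0// mulr_gt0// subr_gt0 exprn_ilt1// normc_ge0.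
have rr : 0 <= normc z < 1 by rewrite normc_ge0.
have [[|K] sK hK] := natmul_expr_small (size P).+2 rr e0; first by [].
have {}hK : 8 * (K.+1%:R * normc z ^+ K.+1) < complex.Im z * (1 - normc z ^+ 2).
  by rewrite mulrC -ltr_pdivlMr.
pose n := K.+1; pose t (k : nat) : R := k%:R * (pi / n%:R).
pose T (k : nat) := complex.Im (ceval P (cis (t k))).
have sP : (size P <= n)%N by rewrite /n; lia.
have n0R : 0 < n%:R :> R by rewrite ltr0n.
have t0 : t 0%N = 0 by rewrite /t mul0r.
have tI (k : nat) : (0 < k < n)%N -> 0 < t k < pi.
  exact: grid_itv.
pose H (k : nat) := \sum_(j < n) (sin (j%:R * t k))%:C * z ^+ j.
have H0 (k : nat) : (0 < k < n)%N -> 0 < complex.Im (H k).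
  by move=> /tI tk; apply: truncated_kernel_gt0.
have T0k : T 0%N = 0.
  by rewrite /T (Im_ceval_cis _ sP) big1// => j _; rewrite t0 mulr0 sin0 mulr0.
have Tge (k : nat) : (k < n)%N -> 0 <= T k.
  case: k => [|k] kn; first by rewrite T0k.
  by apply/T0/tI.
have quad : n%:R / 2 * complex.Im (ceval P z) = \sum_(k < n) T k * complex.Im (H k).
  rewrite (ceval_wide _ sP) Im_sum mulr_sumr.
  under [RHS]eq_bigr => k _ do rewrite Im_sum mulr_sumr.
  rewrite exchange_big /=; apply: eq_bigr => j _.
  under [RHS]eq_bigr => k _ do rewrite Im_scale mulrA.
  rewrite Im_scale -mulr_suml mulrA.
  case: (posnP j) => [->|j0]; first by rewrite expr0 /= !mulr0.
  congr (_ * _); apply/esym; apply: (coef_of_grid_values (N := K)) => //.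
  by have := ltn_ord j; rewrite /n; lia.
have mass : \sum_(k < n) T k * sin (t k) = n%:R / 2.
  have := @coef_of_grid_values R P K n 1 sP isT; rewrite P1 mulr1 => <-.
    by apply: eq_bigr => k _; rewrite mul1r.
  by rewrite /n; lia.
have term_ge0 (k : 'I_n) : 0 <= T k * complex.Im (H k).
  case: (posnP k) => [->|k0]; first by rewrite T0k mul0r.
  by rewrite mulr_ge0 ?Tge// ltW// H0// k0 ltn_ord.
rewrite -(pmulr_rgt0 _ (_ : 0 < n%:R / 2)) ?divr_gt0// quad.
rewrite lt_def sumr_ge0// andbT; apply/negP => /eqP /psumr_eq0P Z.
have : \sum_(k < n) T k * sin (t k) = 0.
  apply: big1 => k _; case: (posnP k) => [->|k0]; first by rewrite T0k mul0r.
  have /eqP := Z (fun i _ => term_ge0 i) k isT.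
  rewrite mulf_eq0 => /orP[/eqP->|/eqP h]; first by rewrite mul0r.
  by have := H0 k; rewrite k0 ltn_ord h ltxx => /(_ isT).
by rewrite mass => /eqP; rewrite gt_eqF// divr_gt0.
Qed.

(** * Typically real polynomials and boundary values *)

Lemma horner_ge0_closure (R : realType) (p : {poly R}) (a : R) :
  (forall e, 0 < e -> exists2 x, `|x - a| < e & 0 <= p.[x]) -> 0 <= p.[a].
Proof.
move=> H; rewrite leNgt; apply/negP => pa.
have Np : 0 < - p.[a] by rewrite oppr_gt0.
have [d d0 /= hd] := poly_cont a p Np.
have [x xa px] := H d d0.
by have := hd x xa; rewrite ltr_norml; lra.
Qed.

Lemma derivable_horner_num (K : numFieldType) (p : {poly K}) (x : K) :
  derivable (horner p) x 1.
Proof.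
elim/poly_ind: p => [|p c IH].
  rewrite (_ : horner 0 = cst 0); first exact: derivable_cst.
  by apply/funext => y; rewrite horner0.
rewrite (_ : horner _ = (horner p * id) + cst c); last first.
  by apply/funext => y; rewrite !hornerE.
apply: derivableD; last exact: derivable_cst.
by apply: derivableM => //; exact: derivable_id.
Qed.

Lemma continuous_horner_num (K : numFieldType) (p : {poly K}) :
  continuous (horner p).
Proof.
move=> x; apply/differentiable_continuous.
exact/derivable1_diffP/derivable_horner_num.
Qed.

Lemma ceval_real (R : realType) (P : {poly R}) (a : R) :
  ceval P a%:C = (P.[a])%:C.
Proof. by rewrite /ceval horner_map. Qed.

Lemma ceval_conj (R : realType) (P : {poly R}) (z : R[i]) :
  ceval P (z^*) = (ceval P z)^*.
Proof.
rewrite !(ceval_wide _ (leqnn _)) rmorph_sum; apply: eq_bigr => j _.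
by rewrite rmorphM rmorphXn /= oppr0.
Qed.

Lemma unit_diskE (R : realType) (z : R[i]) : @unit_disk R z <-> normc z < 1.
Proof. by rewrite /unit_disk /= -ltcR. Qed.

Lemma normc_cis (R : realType) (t : R) : normc (cis t) = 1.
Proof. by rewrite /= cos2Dsin2 sqrtr1. Qed.

(** [Im P(r e^(it))] is a polynomial in [r], positive on [0 < r < 1]. *)
Lemma Im_boundary_ge0 (R : realType) (P : {poly R}) (t : R) :
  typically_real (ceval P) -> 0 < t < pi -> 0 <= complex.Im (ceval P (cis t)).
Proof.
move=> [_ _ TR] t0; have s0 := sin_gt0_pi t0.
pose p := \poly_(j < size P) (P`_j * sin (j%:R * t)).
have pE r : complex.Im (ceval P (r%:C * cis t)) = p.[r].
  rewrite horner_poly (ceval_wide _ (leqnn _)) Im_sum; apply: eq_bigr => j _.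
  by rewrite exprMn -rmorphXn /= !Im_scale cisX /= -mulrA; congr (_ * _); rewrite mulrC.
rewrite -[cis t]mul1r pE; apply: horner_ge0_closure => e e0.
(* any r in (0, 1) at distance less than e from 1 would do *)
pose r := 1 - Num.min (e / 2) (1 / 2).
have m0 : 0 < Num.min (e / 2) (1 / 2 : R) by rewrite lt_min !divr_gt0.
have m1 : Num.min (e / 2) (1 / 2 : R) <= 1 / 2 by rewrite ge_min lexx orbT.
have me : Num.min (e / 2) (1 / 2 : R) <= e / 2 by rewrite ge_min lexx.
have r0 : 0 < r by rewrite /r; lra.
exists r; first by rewrite /r ltr_norml; lra.
have rs : 0 < complex.Im (r%:C * cis t) by rewrite Im_scale mulr_gt0.
rewrite -pE; have := TR (r%:C * cis t).
rewrite pmulr_lgt0// => H; apply/ltW/H.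
  apply/unit_diskE; rewrite normcM normc_cis normc_real mulr1 gtr0_norm// /r; lra.
by move: rs; case: (_ * _) => a b /= b0; rewrite complex_real gt_eqF.
Qed.

Lemma typically_real_of_boundary (R : realType) (P : {poly R}) : P`_1 = 1 ->
  (forall t : R, 0 < t < pi -> 0 <= complex.Im (ceval P (cis t))) ->
  typically_real (ceval P).
Proof.
move=> P1 T0; split.
- by move=> z _; apply: derivable_horner_num.
- move=> z _ /complex_realP [k ->]; rewrite ceval_real; apply/complex_realP; eexists; reflexivity.
move=> z /unit_diskE z1 zI.
have : complex.Im z != 0 by move: zI; case: (z) => a b; rewrite complex_real.
rewrite neq_lt => /orP [y0|y0]; last by rewrite mulr_gt0// Im_ceval_gt0.
have := @Im_ceval_gt0 _ P (z^*) P1 T0; rewrite ceval_conj.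
have -> : complex.Im z^* = - complex.Im z by case: (z).
have -> : complex.Im (ceval P z)^* = - complex.Im (ceval P z) by case: ceval.
have -> : normc z^* = normc z by case: (z) => a b /=; rewrite sqrrN.
by rewrite !oppr_gt0 => /(_ z1 y0) h; rewrite nmulr_rgt0.
Qed.

(** This turns the extremal problem into one on nonnegative sine polynomials. *)
Lemma typically_real_polysP (R : realType) (N : nat) (P : {poly R}) :
  typically_real_polys N P <->
  [/\ (size P <= N.+1)%N, P`_0 = 0, P`_1 = 1 &
      forall t : R, 0 < t < pi -> 0 <= complex.Im (ceval P (cis t))].
Proof.
split=> [] [sP P0 P1 H]; split=> //.
  by move=> t; apply: Im_boundary_ge0.
exact: typically_real_of_boundary.
Qed.

(** * The reflection exchanging maxima and minima *)

(** The coefficients of [- P(-z)].  This involution of [typically_real_polys]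
    reverses the sign of the second coefficient, so it exchanges the maximization
    and the minimization problems. *)
Definition odd_reflection (R : realType) (P : {poly R}) : {poly R} :=
  \poly_(j < size P) (if odd j then P`_j else - P`_j).

Lemma coef_odd_reflection (R : realType) (P : {poly R}) (j : nat) :
  (odd_reflection P)`_j = if odd j then P`_j else - P`_j.
Proof.
rewrite coef_poly; case: ltnP => // sj.
by rewrite nth_default// oppr0 if_same.
Qed.

Lemma odd_reflectionK (R : realType) : involutive (@odd_reflection R).
Proof.
move=> P; apply/polyP => j; rewrite !coef_odd_reflection.
by case: (odd j) => //; rewrite opprK.
Qed.

Lemma ceval_odd_reflection (R : realType) (P : {poly R}) (z : R[i]) :
  ceval (odd_reflection P) z = - ceval P (- z).
Proof.
rewrite (ceval_wide _ (size_poly _ _)) (ceval_wide _ (leqnn (size P))) -sumrN.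
apply: eq_bigr => j _; rewrite coef_odd_reflection exprNn -signr_odd.
case: (odd j); first by rewrite expr1 mulN1r mulrN opprK.
by rewrite expr0 mul1r rmorphN mulNr.
Qed.

Lemma typically_real_odd_reflection (R : realType) (N : nat) (P : {poly R}) :
  typically_real_polys N P -> typically_real_polys N (odd_reflection P).
Proof.
move=> /typically_real_polysP[sP P0 P1 T0]; apply/typically_real_polysP; split.
- exact: leq_trans (size_poly _ _) sP.
- by rewrite coef_odd_reflection P0 oppr0.
- by rewrite coef_odd_reflection P1.
move=> t /andP[t0 tpi]; rewrite ceval_odd_reflection.
have -> : - cis t = (cis (pi - t))^*.
  rewrite /cis cosB sinB cospi sinpi /=; apply/eqP; rewrite eq_complex /=.
  by apply/andP; split; apply/eqP; ring.
rewrite ceval_conj.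
have -> : complex.Im (- (ceval P (cis (pi - t)))^*) = complex.Im (ceval P (cis (pi - t))).
  by case: ceval => a b /=; rewrite opprK.
by apply: T0; apply/andP; split; lra.
Qed.

Lemma minimizes_odd_reflection (R : realType) (N : nat) (P : {poly R}) :
  minimizes_a2 N P -> maximizes_a2 N (odd_reflection P).
Proof.
move=> [TP mP]; split; first exact: typically_real_odd_reflection.
move=> Q /typically_real_odd_reflection /mP; rewrite !coef_odd_reflection /=; lra.
Qed.

Lemma maximizes_odd_reflection (R : realType) (N : nat) (P : {poly R}) :
  maximizes_a2 N P -> minimizes_a2 N (odd_reflection P).
Proof.
move=> [TP mP]; split; first exact: typically_real_odd_reflection.
move=> Q /typically_real_odd_reflection /mP; rewrite !coef_odd_reflection /=; lra.
Qed.

(** * The bound on the second coefficient and its case of equality *)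

(** Chebyshev polynomials of the second kind. *)
Fixpoint chebU (R : realType) (j : nat) : {poly R} :=
  match j with
  | 0 => 1
  | k.+1 => match k with
            | 0 => 2 *: 'X
            | l.+1 => 2 *: 'X * chebU R k - chebU R l
            end
  end.

Lemma chebU_rec (R : realType) (j : nat) :
  chebU R j.+2 = 2 *: 'X * chebU R j.+1 - chebU R j.
Proof. by []. Qed.

Lemma size_chebU (R : realType) (j : nat) : (size (chebU R j) <= j.+1)%N.
Proof.
suff : (size (chebU R j) <= j.+1)%N /\ (size (chebU R j.+1) <= j.+2)%N by case.
elim: j => [|j [IH1 IH2]]; first by
  rewrite size_poly1 (leq_trans (size_scale_leq _ _))// size_polyX.
split=> //; rewrite chebU_rec (leq_trans (size_polyD _ _))// geq_max size_polyN.
rewrite (leq_trans IH1) ?andbT; last by lia.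
rewrite -scalerAl (leq_trans (size_scale_leq _ _))//.
by rewrite mulrC (leq_trans (size_polyMleq _ _))// size_polyX addn2.
Qed.

Lemma sin_double (R : realType) (t : R) : sin (2 * t) = 2 * sin t * cos t.
Proof. by rewrite [2 * t]mulr_natl sin_mulr2n; ring. Qed.

Lemma chebU_cos (R : realType) (j : nat) (t : R) :
  sin t * (chebU R j).[cos t] = sin (j.+1%:R * t).
Proof.
suff : sin t * (chebU R j).[cos t] = sin (j.+1%:R * t) /\
   sin t * (chebU R j.+1).[cos t] = sin (j.+2%:R * t) by case.
elim: j => [|j [IH1 IH2]].
  rewrite hornerC mulr1 mul1r (_ : chebU R 1 = 2 *: 'X)// hornerZ hornerX.
  by split=> //; rewrite sin_double; ring.
split=> //; rewrite chebU_rec !hornerE.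
rewrite mulrBr mulrCA -mulrA IH1.
rewrite mulrCA IH2.
rewrite (_ : j.+3%:R * t = j.+2%:R * t + t); last by rewrite -[j.+3%:R]natr1; ring.
rewrite (_ : j.+1%:R * t = j.+2%:R * t - t); last by rewrite -[j.+2%:R]natr1; ring.
by rewrite sinB sinD; ring.
Qed.

(** The polynomial [p] with [Im P(e^(it)) = sin t * p(cos t)], for [P] of degree
    at most [N]; its own degree is at most [N - 1]. *)
Definition sine_quotient (R : realType) (N : nat) (P : {poly R}) : {poly R} :=
  \sum_(j < N) P`_j.+1 *: chebU R j.

Lemma size_sine_quotient (R : realType) (N : nat) (P : {poly R}) :
  (size (sine_quotient N P) <= N)%N.
Proof.
apply: (leq_trans (size_sum _ _ _)); apply/bigmax_leqP => j _.
apply: (leq_trans (size_scale_leq _ _)).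
exact: leq_trans (size_chebU _ _) (ltn_ord j).
Qed.

Lemma sine_quotientB (R : realType) (N : nat) (P Q : {poly R}) :
  sine_quotient N (P - Q) = sine_quotient N P - sine_quotient N Q.
Proof.
by rewrite /sine_quotient -sumrB; apply: eq_bigr => j _; rewrite coefB scalerBl.
Qed.

Lemma Im_ceval_sine_quotient (R : realType) (N : nat) (P : {poly R}) (t : R) :
  (size P <= N.+1)%N ->
  complex.Im (ceval P (cis t)) = sin t * (sine_quotient N P).[cos t].
Proof.
move=> sP; rewrite (Im_ceval_cis _ sP) big_ord_recl /= mul0r sin0 mulr0 add0r.
rewrite /sine_quotient horner_sum mulr_sumr; apply: eq_bigr => j _.
by rewrite hornerZ mulrCA chebU_cos.
Qed.

Lemma sine_quotient_ge0 (R : realType) (N : nat) (P : {poly R}) (x : R) :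
  typically_real_polys N P -> -1 < x < 1 -> 0 <= (sine_quotient N P).[x].
Proof.
move=> /typically_real_polysP[sP _ _ T0] /andP[x0 x1].
have t0 : 0 < acos x < pi by rewrite acos_gt0 ?acos_ltpi ?x1 ?x0 ?ltW.
have xI : x \in `[(-1), 1] by rewrite in_itv /= !ltW.
have := T0 _ t0; rewrite (Im_ceval_sine_quotient _ sP) acosK//.
by rewrite pmulr_rge0// sin_gt0_pi.
Qed.

(** Writing [p = g * (X - a)], the sign of [p] makes [g] nonnegative to the
    right of [a] and nonpositive to the left, so [g] vanishes at [a] as well. *)
Lemma double_root_of_ge0 (R : realType) (p : {poly R}) (a : R) :
  (forall x, -1 < x < 1 -> 0 <= p.[x]) -> -1 < a < 1 -> p.[a] = 0 ->
  ('X - a%:P) ^+ 2 %| p.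
Proof.
move=> p0 /andP[a0 a1] pa.
have /factor_theorem [g pE] : root p a by apply/eqP.
have near_pts (e : R) : 0 < e -> exists2 h, 0 < h < e & (-1 < a - h) /\ (a + h < 1).
  move=> e0; pose h := Num.min (e / 2) (Num.min ((1 - a) / 2) ((1 + a) / 2)).
  have h0 : 0 < h by rewrite /h !lt_min !divr_gt0//; lra.
  have h1 : h <= e / 2 by rewrite /h !ge_min lexx.
  have h2 : h <= (1 - a) / 2 by rewrite /h !ge_min lexx orbT.
  have h3 : h <= (1 + a) / 2 by rewrite /h !ge_min lexx !orbT.
  by exists h; [apply/andP; split|split]; lra.
have g1 : 0 <= g.[a].
  apply: horner_ge0_closure => e /near_pts[h /andP[h0 he] [h1 h2]].
  exists (a + h); first by rewrite addrC addKr gtr0_norm.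
  have := p0 (a + h); rewrite pE !hornerE [a + h - a]addrC addKr pmulr_lge0//.
  by apply; lra.
have g2 : 0 <= (- g).[a].
  apply: horner_ge0_closure => e /near_pts[h /andP[h0 he] [h1 h2]].
  exists (a - h); first by rewrite addrC addKr normrN gtr0_norm.
  have := p0 (a - h); rewrite pE !hornerE [a - h - a]addrC addKr mulrN -mulNr pmulr_lge0//.
  by apply; lra.
have ga : g.[a] = 0 by apply/eqP; move: g2; rewrite hornerN eq_le g1; lra.
have /factor_theorem [k gE] : root g a by apply/eqP.
by rewrite pE gE -mulrA -expr2 dvdp_mulIr.
Qed.

Lemma prod_sqr_dvdp (F : fieldType) (s : seq F) (p : {poly F}) :
  uniq s -> (forall x, x \in s -> ('X - x%:P) ^+ 2 %| p) ->
  \prod_(x <- s) ('X - x%:P) ^+ 2 %| p.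
Proof.
elim: s => [|a s IH] /=; first by rewrite big_nil dvd1p.
move=> /andP[as_ us] H; rewrite big_cons Gauss_dvdp.
  rewrite H ?mem_head// IH// => x xs.
  by apply: H; rewrite in_cons xs orbT.
rewrite coprimep_pexpl// coprimep_sym coprimep_XsubC prodrXl -/(root _ _).
by rewrite rootE horner_exp expf_eq0 /= -rootE root_prod_XsubC.
Qed.

(** Since [sin (2t) = 2 cos t sin t], quadrature presents [P`_2] as the average
    of [2 cos t_k] with the weights [(2 / n) T(t_k) sin t_k], whose total mass is
    [P`_1 = 1].  The hypothesis [N + 3 = 2n] is what makes the grid exact for
    both [P`_1] and [P`_2]. *)
Lemma a2_gap (R : realType) (N n : nat) (P : {poly R}) :
  (N + 3 = 2 * n)%N -> (2 <= N)%N -> typically_real_polys N P ->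
  n%:R / 2 * (2 * cos (pi / n%:R) - P`_2) =
  \sum_(k < n) (complex.Im (ceval P (cis (k%:R * (pi / n%:R))))
     * sin (k%:R * (pi / n%:R))) * (2 * (cos (pi / n%:R) - cos (k%:R * (pi / n%:R)))).
Proof.
move=> Nn N2 /typically_real_polysP[sP P0 P1 T0].
have h1 := @coef_of_grid_values R P N n 1 sP isT.
have h2 := @coef_of_grid_values R P N n 2 sP isT.
rewrite P1 mulr1 in h1.
rewrite mulrBr -h2 -?h1 ; [|lia|lia].
rewrite mulr_suml -sumrB; apply: eq_bigr => k _.
by rewrite mul1r sin_double; ring.
Qed.

Lemma a2_gap_term_ge0 (R : realType) (N n : nat) (P : {poly R}) (k : nat) :
  (k < n)%N -> typically_real_polys N P ->
  0 <= (complex.Im (ceval P (cis (k%:R * (pi / n%:R))))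
     * sin (k%:R * (pi / n%:R))) * (2 * (cos (pi / n%:R) - cos (k%:R * (pi / n%:R)))).
Proof.
move=> kn TP; case: (posnP k) => [->|k0]; first by rewrite mul0r sin0 mulr0 mul0r.
have tk := @grid_itv R n k; rewrite k0 kn in tk; have {}tk := tk isT.
have [_ _ _ T0] := (typically_real_polysP _ _).1 TP.
apply: mulr_ge0; first exact: mulr_ge0 (T0 _ tk) (ltW (sin_gt0_pi tk)).
rewrite mulr_ge0// subr_ge0.
move: k0; rewrite leq_eqVlt => /predU1P[<-|k1]; first by rewrite mul1r.
rewrite -[pi / n%:R in leRHS]mul1r; apply/ltW/(@cos_grid_lt R n 1 k).
by rewrite k1 ltnW.
Qed.

Lemma a2_le (R : realType) (N n : nat) (P : {poly R}) :
  (N + 3 = 2 * n)%N -> (2 <= N)%N -> typically_real_polys N P ->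
  P`_2 <= 2 * cos (pi / n%:R).
Proof.
move=> Nn N2 TP; rewrite -subr_ge0.
have n0 : 0 < n%:R / 2 :> R by rewrite divr_gt0// ltr0n; lia.
rewrite -(pmulr_rge0 _ n0) (a2_gap Nn)// sumr_ge0// => k _.
exact: a2_gap_term_ge0 (ltn_ord k) TP.
Qed.

Lemma a2_max_grid_zeros (R : realType) (N n : nat) (P : {poly R}) (k : nat) :
  (N + 3 = 2 * n)%N -> (2 <= N)%N -> typically_real_polys N P ->
  P`_2 = 2 * cos (pi / n%:R) -> (2 <= k < n)%N ->
  complex.Im (ceval P (cis (k%:R * (pi / n%:R)))) = 0.
Proof.
move=> Nn N2 TP a2 /andP[k2 kn].
have := a2_gap Nn N2 TP; rewrite a2 subrr mulr0 => /esym /psumr_eq0P Z.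
have /eqP := Z (fun i _ => a2_gap_term_ge0 (ltn_ord i) TP) (Ordinal kn) isT.
have tk : 0 < sin (k%:R * (pi / n%:R) : R) by rewrite sin_gt0_pi// grid_itv//; lia.
have ck : cos (k%:R * (pi / n%:R)) < cos (1%:R * (pi / n%:R) : R).
  by apply: cos_grid_lt; lia.
rewrite /= mul1r in ck *.
rewrite !mulf_eq0 (gt_eqF tk) pnatr_eq0 subr_eq0 (gt_eqF ck) !orbF.
by move/eqP.
Qed.

(** Quadrature on a grid finer than the degree recovers all coefficients. *)
Lemma poly_eq_of_boundary (R : realType) (D : {poly R}) :
  D`_0 = 0 -> (forall t, complex.Im (ceval D (cis t)) = 0) -> D = 0.
Proof.
move=> D0 T0; apply/polyP => -[|l]; rewrite coef0//.
pose n := (size D + l.+2)%N.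
have sD : (size D <= (size D).+1)%N by lia.
have := @coef_of_grid_values R D (size D) n l.+1 sD isT.
rewrite big1; last by move=> k _; rewrite T0 mul0r.
move=> /(_ _)/esym/eqP; rewrite mulf_eq0 => /(_ _) /orP[]; [by rewrite /n; lia| |by move/eqP].
by rewrite gt_eqF// divr_gt0// ltr0n /n; lia.
Qed.

(** For a maximizer the quotient by [sin t] is nonnegative and vanishes at the
    interior points [x_k = cos t_k], [2 <= k < n], hence doubly.  The quotient of
    a difference of two maximizers inherits these [n - 2] double roots.  Its value
    at [x_1] vanishes too, because the quadrature for the coefficient 1 has only
    that node left.  These are [2n - 3 = N] roots, one more than the degree
    [N - 1] allows. *)
Lemma a2_max_unique (R : realType) (N n : nat) (P Q : {poly R}) :
  (N + 3 = 2 * n)%N -> (2 <= N)%N ->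
  typically_real_polys N P -> typically_real_polys N Q ->
  P`_2 = 2 * cos (pi / n%:R) -> Q`_2 = 2 * cos (pi / n%:R) -> P = Q.
Proof.
move=> Nn N2 TP TQ P2 Q2.
have [sP P0 P1 _] := (typically_real_polysP _ _).1 TP.
have [sQ Q0 Q1 _] := (typically_real_polysP _ _).1 TQ.
pose x (k : nat) : R := cos (k%:R * (pi / n%:R)).
have xlt j k : (j < k <= n)%N -> x k < x j by apply: cos_grid_lt.
pose s := [seq x k | k <- iota 2 (n - 2)].
have xI (k : nat) : (0 < k < n)%N -> -1 < x k < 1.
  move=> /andP[k0 kn]; apply/andP; split.
    have := xlt k n; rewrite kn leqnn => /(_ isT); apply: le_lt_trans; exact: cos_geN1.
  by have := xlt 0 k; rewrite k0 ltnW// => /(_ isT)/lt_le_trans; apply; exact: cos_le1.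
have dbl (S : {poly R}) : typically_real_polys N S -> S`_2 = 2 * cos (pi / n%:R) ->
    forall k, (2 <= k < n)%N -> ('X - (x k)%:P) ^+ 2 %| sine_quotient N S.
  move=> TS S2 k kn; have k0n : (0 < k < n)%N by lia.
  apply: double_root_of_ge0; [by move=> y; apply: sine_quotient_ge0|exact: xI|].
  have [sS _ _ _] := (typically_real_polysP _ _).1 TS.
  have /eqP := a2_max_grid_zeros Nn N2 TS S2 kn.
  rewrite (Im_ceval_sine_quotient _ sS) mulf_eq0 gt_eqF ?sin_gt0_pi ?grid_itv//.
  by move=> /eqP.
pose D := P - Q.
have sD : (size D <= N.+1)%N.
  by rewrite (leq_trans (size_polyD _ _))// geq_max size_polyN sP.
have n0 : (1 < n)%N by lia.
have D1 : root (sine_quotient N D) (x 1%N).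
  have N1 : (N + 1 < 2 * n)%N by lia.
  have := @coef_of_grid_values R D N n 1 sD isT N1.
  rewrite coefB P1 Q1 subrr mulr0 (bigD1 (Ordinal n0)) //= big1; last first.
    move=> k kn1; rewrite (Im_ceval_sine_quotient _ sD).
    have [k2|] := leqP 2 k; last first.
      rewrite ltnS leq_eqVlt ltnS leqn0 => /orP[/eqP k1|/eqP->].
        by case/eqP: kn1; apply/val_inj.
      by rewrite mul0r sin0 mul0r mul0r.
    have kk : (2 <= k < n)%N by rewrite k2 ltn_ord.
    rewrite sine_quotientB hornerD hornerN -/(x k).
    have /(dvdp_trans (dvdp_mulIl _ _)) := dbl P TP P2 k kk; rewrite dvdp_XsubCl => /rootP ->.
    have /(dvdp_trans (dvdp_mulIl _ _)) := dbl Q TQ Q2 k kk; rewrite dvdp_XsubCl => /rootP ->.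
    by rewrite subr0 mulr0 mul0r.
  have s1 : sin (1 * (pi / n%:R)) != 0 :> R.
    by rewrite gt_eqF// sin_gt0_pi// (@grid_itv R n 1).
  rewrite addr0 (Im_ceval_sine_quotient _ sD) mul1r in s1 *.
  by rewrite !mul1r => /eqP; rewrite !mulf_eq0 (negbTE s1) orbF rootE /x mul1r.
have us : uniq s.
  rewrite map_inj_in_uniq ?iota_uniq// => i j; rewrite !mem_iota => hi hj xij.
  have := xlt i j; have := xlt j i; rewrite xij ltxx.
  case: (ltngtP i j) => // ij h1 h2; [have := h2|have := h1]; lia.
have H : \prod_(y <- s) ('X - y%:P) ^+ 2 * ('X - (x 1%N)%:P) %| sine_quotient N D.
  rewrite Gauss_dvdp.
    rewrite dvdp_XsubCl D1 andbT; apply: prod_sqr_dvdp => // y /mapP[k].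
    rewrite mem_iota => kI ->.
    have kk : (2 <= k < n)%N by lia.
    by rewrite sine_quotientB dvdp_sub ?dbl.
  rewrite coprimep_XsubC rootE prodrXl horner_exp expf_eq0 /= -rootE root_prod_XsubC.
  apply/mapP => -[k]; rewrite mem_iota => kI xk.
  by have := xlt 1%N k; rewrite xk ltxx; lia.
have D0 : sine_quotient N D = 0.
  apply/eqP; apply: contraTT isT => nz; have := dvdp_leq nz H.
  have -> : size (\prod_(y <- s) ('X - y%:P) ^+ 2 * ('X - (x 1%N)%:P)) = N.+1.
    rewrite size_Mmonic ?monicXsubC ?size_XsubC// ?addn2 /=.
      rewrite prodrXl expr2 size_Mmonic ?monic_neq0 ?monic_prod_XsubC//.
      rewrite size_prod_XsubC size_map size_iota; lia.
    rewrite prodrXl monic_neq0// monic_exp// monic_prod_XsubC//.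
  by rewrite ltnNge size_sine_quotient.
apply/eqP; rewrite -subr_eq0; apply/eqP/poly_eq_of_boundary.
  by rewrite coefB P0 Q0 subrr.
by move=> t; rewrite (Im_ceval_sine_quotient _ sD) D0 horner0 mulr0.
Qed.

(** * The extremal polynomial *)

(** Without its term in [z^M], the closed form of the extremal polynomial is a
    rational function with double poles at [e^(+-i theta)] and simple poles at [1]
    and [-1], so its coefficients combine [j sin (j theta)], [sin (j theta)],
    [cos (j theta)], [1] and [(-1)^j].  The constants are chosen to give 0 and 1
    at the indices 0 and 1, and 0 from [M - 2] to [M + 1]. *)
Definition extremal_coef (R : realType) (theta : R) (M j : nat) : R :=
  ((M%:R - j%:R) * sin theta * sin (j%:R * theta)
   - 2 * cos theta * cos (j%:R * theta)
   + (if odd j then 1 + cos theta ^+ 2 else 2 * cos theta))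
  / (M%:R * sin theta ^+ 2).

Definition extremal_second_difference (R : realType) (theta : R) (M j : nat) : R :=
  2 / M%:R * ((if odd j then 1 else cos theta) - cos (j.+1%:R * theta)).

Lemma extremal_coef_second_difference (R : realType) (theta : R) (M j : nat) :
  M%:R != 0 :> R -> sin theta != 0 ->
  extremal_coef theta M j.+2 - 2 * cos theta * extremal_coef theta M j.+1
    + extremal_coef theta M j = extremal_second_difference theta M j.
Proof.
move=> M0 s0; rewrite /extremal_coef /extremal_second_difference.
have e2 : j.+2%:R * theta = j.+1%:R * theta + theta by rewrite -[j.+2%:R]natr1; ring.
have e0 : j%:R * theta = j.+1%:R * theta - theta by rewrite -[j.+1%:R]natr1; ring.
rewrite e2 e0 sinD cosD sinB cosB.
set S := sin (j.+1%:R * theta); set C := cos (j.+1%:R * theta).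
rewrite -[j.+2%:R]natr1 -[j.+1%:R]natr1 /= negbK.
have := cos2Dsin2 theta; move: s0.
set s := sin theta; set c := cos theta => s0 c2.
have D0 : M%:R * s ^+ 2 != 0 by rewrite mulf_neq0// expf_neq0.
have over_denom (x y z w : R) : x - 2 * c * y + z = w * (M%:R * s ^+ 2) ->
    x / (M%:R * s ^+ 2) - 2 * c * (y / (M%:R * s ^+ 2)) + z / (M%:R * s ^+ 2) = w.
  by move=> h; apply: (mulIf D0); rewrite -h; field; rewrite s0 M0.
apply: over_denom.
rewrite (_ : 2 / M%:R * _ * _ = 2 * s ^+ 2 * ((if odd j then 1 else c) - C));
  last by case: (odd j); field.
have s2 : s ^+ 2 = 1 - c ^+ 2 by rewrite -c2 addrC addKr.
case: (odd j) => /=; ring: s2.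
Qed.

(** The second application of the operator kills the trigonometric terms, and
    only a constant on odd indices remains: [z / (1 - z^2)] in the closed form. *)
Lemma extremal_fourth_difference (R : realType) (theta : R) (M j : nat) :
  M%:R != 0 :> R ->
  extremal_second_difference theta M j.+2 - 2 * cos theta * extremal_second_difference theta M j.+1
    + extremal_second_difference theta M j = if odd j then 4 / M%:R * sin theta ^+ 2 else 0.
Proof.
move=> M0; rewrite /extremal_second_difference.
have e2 : j.+3%:R * theta = j.+2%:R * theta + theta by rewrite -[j.+3%:R]natr1; ring.
have e0 : j.+1%:R * theta = j.+2%:R * theta - theta by rewrite -[j.+2%:R]natr1; ring.
rewrite e2 e0 cosD cosB sin2cos2 /= negbK.
by case: (odd j) => /=; field.
Qed.

Lemma extremal_coef0 (R : realType) (theta : R) (M : nat) : extremal_coef theta M 0 = 0.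
Proof. by rewrite /extremal_coef /= !mul0r sin0 cos0 mulr0 mulr1 add0r addNr mul0r. Qed.

Lemma extremal_coef1 (R : realType) (theta : R) (M : nat) :
  M%:R != 0 :> R -> sin theta != 0 -> extremal_coef theta M 1 = 1.
Proof.
move=> M0 s0; have D0 : M%:R * sin theta ^+ 2 != 0 by rewrite mulf_neq0// expf_neq0.
apply: (mulIf D0); rewrite mulfVK// /= !mul1r.
by have := sin2cos2 theta => s2; ring: s2.
Qed.

Lemma extremal_coef2 (R : realType) (theta : R) (M : nat) :
  M%:R != 0 :> R -> sin theta != 0 -> extremal_coef theta M 2 = 2 * cos theta.
Proof.
move=> M0 s0; have D0 : M%:R * sin theta ^+ 2 != 0 by rewrite mulf_neq0// expf_neq0.
apply: (mulIf D0); rewrite mulfVK// /= [2%:R * theta]mulr_natl sin_mulr2n cos_mulr2n.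
by have := sin2cos2 theta => s2; ring: s2.
Qed.

(** Only the factor [M - j] is not [M]-periodic. *)
Lemma extremal_coef_period (R : realType) (theta : R) (M j : nat) :
  M%:R != 0 :> R -> sin theta != 0 ->
  ~~ odd M -> sin (M%:R * theta) = 0 -> cos (M%:R * theta) = 1 ->
  extremal_coef theta M (M + j) = extremal_coef theta M j
     - sin (j%:R * theta) / sin theta.
Proof.
move=> M0 s0 Modd sM cM; rewrite /extremal_coef oddD (negbTE Modd) /=.
rewrite (_ : (M + j)%:R * theta = M%:R * theta + j%:R * theta); last by rewrite natrD mulrDl.
rewrite cosD sinD sM cM natrD; set S := sin (j%:R * theta).
by case: (odd j); field; rewrite s0 M0.
Qed.

Lemma extremal_second_difference_period (R : realType) (theta : R) (M j : nat) :
  ~~ odd M -> sin (M%:R * theta) = 0 -> cos (M%:R * theta) = 1 ->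
  extremal_second_difference theta M (M + j) = extremal_second_difference theta M j.
Proof.
move=> Modd sM cM; rewrite /extremal_second_difference oddD (negbTE Modd) /=.
rewrite (_ : (M + j).+1%:R * theta = M%:R * theta + j.+1%:R * theta).
  by rewrite cosD sM cM mul0r subr0 mul1r.
by rewrite -addnS natrD mulrDl.
Qed.

(** At [M] and [M + 1] this follows from the values at 0 and 1 and
    [extremal_coef_period]; the recurrence, run backwards, carries it to [M - 1]
    and [M - 2].  Hence the degree is at most [M - 3], and truncating at [M]
    leaves no boundary terms. *)
Lemma extremal_coef_vanish (R : realType) (theta : R) (M j : nat) :
  M%:R != 0 :> R -> sin theta != 0 ->
  ~~ odd M -> sin (M%:R * theta) = 0 -> cos (M%:R * theta) = 1 ->
  (M <= j + 2)%N -> (j < M + 2)%N -> extremal_coef theta M j = 0.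
Proof.
move=> M0 s0 Modd sM cM.
have aM : extremal_coef theta M M = 0.
  by rewrite -[X in extremal_coef _ _ X]addn0 extremal_coef_period//
    extremal_coef0 mul0r sin0 mul0r subrr.
have aM1 : extremal_coef theta M M.+1 = 0.
  by rewrite -addn1 extremal_coef_period// extremal_coef1// mul1r divff ?subrr//.
have {}Modd : odd M = false by apply/negbTE.
case: M => [|[|M]] in M0 Modd sM cM aM aM1 *; [by rewrite eqxx in M0|by []|].
have d1 : extremal_second_difference theta M.+2 M.+1 = 0.
  by move: Modd => /= /negbFE oM; rewrite /extremal_second_difference /= oM cM subrr mulr0.
have d0 : extremal_second_difference theta M.+2 M = 0.
  have -> : extremal_second_difference theta M.+2 M = 2 / M.+2%:R * (cos theta - cos (M.+1%:R * theta)).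
    by move: Modd => /= /negbFE oM; rewrite /extremal_second_difference; case: (odd M) oM.
  have -> : M.+1%:R * theta = M.+2%:R * theta - theta by rewrite -[M.+2%:R]natr1; ring.
  by rewrite cosB cM sM mul0r addr0 mul1r subrr mulr0.
have := extremal_coef_second_difference M.+1 M0 s0; rewrite d1 aM1 aM mulr0 subr0 add0r => aM'.
have := extremal_coef_second_difference M M0 s0; rewrite d0 aM aM' mulr0 subr0 add0r => aM''.
move=> h1 h2; have : [|| j == M, j == M.+1, j == M.+2 | j == M.+3] by lia.
by case/or4P => /eqP->.
Qed.

Lemma odd_geometric_sum (K : comNzRingType) (z : K) (M : nat) : ~~ odd M ->
  (1 - z ^+ 2) * (\sum_(j < M) (if odd j then 1 else 0) * z ^+ j) = z * (1 - z ^+ M).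
Proof.
move=> /even_halfK <-; elim: M./2 => [|n IH]; first by rewrite big_ord0 expr0 subrr !mulr0.
rewrite doubleS !big_ord_recr /= odd_double /= mul0r addr0 mulrDr IH mul1r.
by rewrite !exprS; ring.
Qed.

Definition extremal_poly (R : realType) (theta : R) (N : nat) : {poly R} :=
  \poly_(j < N.+1) extremal_coef theta (N + 3) j.

(** Two applications of [second_difference_sum]: the first gives
    [q P = z + z^2 S] with [S] the sum of the differences, the second gives
    [q S (1 - z^2) = kappa z (1 - z^M)]. *)
Lemma ceval_extremal_poly (R : realType) (theta : R) (N : nat) (z : R[i]) :
  let M := (N + 3)%N in
  let q := 1 - 2 * z * (cos theta)%:C + z ^+ 2 in
  sin theta != 0 -> ~~ odd M -> sin (M%:R * theta) = 0 -> cos (M%:R * theta) = 1 ->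
  q ^+ 2 * (1 - z ^+ 2) * ceval (extremal_poly theta N) z =
  z * q * (1 - z ^+ 2)
    + (4 / M%:R * sin theta ^+ 2)%:C * z ^+ 3 * (1 - z ^+ M).
Proof.
move=> M q s0 Modd sM cM.
have M0 : M%:R != 0 :> R by rewrite pnatr_eq0 /M addn3.
set c := (cos theta)%:C; set kappa := (_)%:C.
pose a j := (extremal_coef theta M j)%:C : R[i].
pose e j := (extremal_second_difference theta M j)%:C : R[i].
have vanish j : (M <= j + 2)%N -> (j < M + 2)%N -> a j = 0.
  by move=> h1 h2; rewrite /a extremal_coef_vanish.
have aE : ceval (extremal_poly theta N) z = \sum_(j < M) a j * z ^+ j.
  have sP : (size (extremal_poly theta N) <= M)%N.
    by rewrite (leq_trans (size_poly _ _))// /M addn3 ltnW.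
  rewrite (ceval_wide _ sP); apply: eq_bigr => j _; rewrite coef_poly.
  case: ltnP => // Nj; have jM : (j < M)%N by [].
  rewrite vanish//; last by rewrite ltn_addr.
  by rewrite [X in (X <= _)%N]addn3 addn2 !ltnS.
have complexify (x y w : R) :
    (x - 2 * cos theta * y + w)%:C = x%:C - 2 * c * y%:C + w%:C :> R[i].
  by rewrite rmorphD rmorphB !rmorphM rmorph_nat.
have eE j : a j.+2 - 2 * c * a j.+1 + a j = e j.
  by rewrite /e -(extremal_coef_second_difference _ M0 s0) complexify.
have kE j : e j.+2 - 2 * c * e j.+1 + e j = kappa * (if odd j then 1 else 0).
  transitivity ((if odd j then 4 / M%:R * sin theta ^+ 2 else 0)%:C : R[i]).
    by rewrite -(extremal_fourth_difference theta _ M0) complexify.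
  by case: (odd j); rewrite ?mulr1 ?mulr0 ?rmorph0.
have a0 : a 0%N = 0 by rewrite /a extremal_coef0.
have a1 : a 1%N = 1 by rewrite /a extremal_coef1.
have a2 : a 2%N = 2 * c by rewrite /a extremal_coef2// rmorphM rmorph_nat.
have e0 : e 0%N = 0 by rewrite -eE a0 a1 a2; ring.
have e1 : e 1%N = kappa.
  rewrite /e /kappa /extremal_second_difference /= [2%:R * theta]mulr_natl cos_mulr2n sin2cos2; congr _%:C.
  by field.
have eM : e M = 0 by rewrite -e0 /e -[X in extremal_second_difference _ _ X]addn0 extremal_second_difference_period.
have eM1 : e M.+1 = kappa by rewrite -e1 /e -addn1 extremal_second_difference_period.
have qE : q * (\sum_(j < M) e j * z ^+ j) * (1 - z ^+ 2) = kappa * z * (1 - z ^+ M).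
  rewrite second_difference_sum e0 e1 eM eM1.
  under eq_bigr => j _ do rewrite kE -mulrA.
  rewrite -mulr_sumr; set S := \sum_(j < M) _.
  have SE : (1 - z ^+ 2) * S = z * (1 - z ^+ M) by apply: odd_geometric_sum.
  transitivity (kappa * z * (1 - z ^+ 2) * (1 - z ^+ M) + kappa * z ^+ 2 * ((1 - z ^+ 2) * S)).
    by rewrite [z ^+ M.+1]exprS; ring.
  by rewrite SE; ring.
have qP : q * (\sum_(j < M) a j * z ^+ j) = z + z ^+ 2 * (\sum_(j < M) e j * z ^+ j).
  rewrite second_difference_sum a0 a1 !vanish ?addn2 ?addn0//; try lia.
  under eq_bigr => j _ do rewrite eE.
  by ring.
rewrite aE; transitivity (q * (1 - z ^+ 2) * (q * (\sum_(j < M) a j * z ^+ j))); first by ring.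
rewrite qP mulrDr; congr (_ + _); first by ring.
transitivity (z ^+ 2 * (q * (\sum_(j < M) e j * z ^+ j) * (1 - z ^+ 2))); first by ring.
by rewrite qE; ring.
Qed.

(** At [z = e^(it)] the factors are [q = 2 z (cos t - cos theta)] and
    [1 - z^2 = - 2 i z sin t]; dividing the polynomial identity by [z^3] and taking
    real parts leaves [1 - cos (Mt) = 2 sin (Mt / 2)^2]. *)
Lemma Im_extremal_poly (R : realType) (theta : R) (N : nat) (t : R) :
  let M := (N + 3)%N in
  sin theta != 0 -> ~~ odd M -> sin (M%:R * theta) = 0 -> cos (M%:R * theta) = 1 ->
  (cos t - cos theta) ^+ 2 * sin t * complex.Im (ceval (extremal_poly theta N) (cis t))
  = sin theta ^+ 2 / M%:R * sin (M%:R / 2 * t) ^+ 2.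
Proof.
move=> M s0 Modd sM cM.
have M0 : M%:R != 0 :> R by rewrite pnatr_eq0 /M addn3.
have := @ceval_extremal_poly R theta N (cis t) s0 Modd sM cM.
rewrite -/M; set P := ceval _ _; set kappa := 4 / M%:R * sin theta ^+ 2.
pose d := cos t - cos theta; set z := cis t.
have z0 : z != 0.
  apply/negP => /eqP z0; have := normc_cis t; rewrite -/z z0 normc0 => /eqP.
  by rewrite eq_sym oner_eq0.
have -> : 1 - 2 * z * (cos theta)%:C + z ^+ 2 = (2 * d)%:C * z.
  rewrite expr2 /z /d /cis; apply/eqP; rewrite eq_complex /=.
  by apply/andP; split; apply/eqP; have := sin2cos2 t => s2; ring: s2.
have -> : 1 - z ^+ 2 = (0 -i* (2 * sin t)) * z.
  rewrite expr2 /z /cis; apply/eqP; rewrite eq_complex /=.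
  by apply/andP; split; apply/eqP; have := sin2cos2 t => s2; ring: s2.
set w := 0 -i* (2 * sin t).
move=> h; have {}h : (2 * d)%:C ^+ 2 * w * P = (2 * d)%:C * w + kappa%:C * (1 - z ^+ M).
  apply: (mulIf (expf_neq0 3 z0)).
  transitivity (((2 * d)%:C * z) ^+ 2 * (w * z) * P); first by ring.
  by rewrite h; ring.
have {h} : 8 * (d ^+ 2 * sin t * complex.Im P) = kappa * (1 - cos (M%:R * t)).
  move: h; rewrite cisX /w; case: P => x y /=; rewrite /cis expr2.
  by move=> /(congr1 (@complex.Re R)) /=; lra.
have -> : cos (M%:R * t) = 1 - 2 * sin (M%:R / 2 * t) ^+ 2.
  rewrite (_ : M%:R * t = (M%:R / 2 * t) *+ 2); last by rewrite -mulr_natl; field.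
  by rewrite cos_mulr2n cos2sin2; ring.
move=> h; apply: (mulfI (_ : 8 != 0 :> R)) => //; rewrite h /kappa.
by field; rewrite M0.
Qed.

(** * Removable singularities *)

Lemma cvg_punctured_of_eq (K : numFieldType) (F g : K -> K) (z : K) :
  {for z, continuous F} -> (\forall w \near z^', F w = g w) ->
  g w @[w --> z^'] --> F z.
Proof.
move=> cF Fg; apply: (cvg_trans (near_eq_cvg Fg)).
exact/continuous_withinNx.
Qed.

(** Roots of a nonzero polynomial are isolated: divide out the root [z]. *)
Lemma near_horner_neq0 (K : numFieldType) (p : {poly K}) (z : K) :
  p != 0 -> \forall w \near z^', p.[w] != 0.
Proof.
move=> p0; have [m [q qz pE]] := multiplicity_XsubC p z.
have {}qz : q.[z] != 0 by move: qz; rewrite p0 /=.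
have cq := (continuous_withinNx _ _).1 (@continuous_horner_num _ q z).
have qw0 : \forall w \near z^', q.[w] != 0 by exact: (cvgr_neq0 _ cq qz).
apply: filterS2 (nbhs_dnbhs_neq z) qw0 => w wz qw.
by rewrite pE hornerM mulf_neq0// horner_exp hornerXsubC expf_neq0// subr_eq0.
Qed.

(** * The extremal problem solved *)

Theorem theorem4p3 (R : realType) (N : nat) (hN : (2 <= N)%N) (oddN : odd N) :
  let theta : R := 2 * pi / (N + 3)%:R in
  let q (z : R[i]) := 1 - 2 * z * (cos theta)%:C + z ^+ 2 in
  exists Pmax Pmin : {poly R},
    [/\ unique (@maximizes_a2 R N) Pmax,
        unique (@minimizes_a2 R N) Pmin,
        @eq_mod_removable R[i] [set: R[i]]
          [set z | q z = 0 \/ 1 - z ^+ 2 = 0]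
          (ceval Pmax)
          (fun z => z / q z
             + (4 / (N + 3)%:R * sin theta ^+ 2)%:C
               * (z ^+ 3 / (1 - z ^+ 2))
               * ((1 - z ^+ (N + 3)) / q z ^+ 2)),
        (forall t : R, 0 < t < pi -> 0 <= complex.Im (ceval Pmax (cis t))) /\
        @eq_mod_removable R [set t : R | 0 < t < pi]
          [set t | cos t - cos theta = 0]
          (fun t => complex.Im (ceval Pmax (cis t)))
          (fun t => sin theta ^+ 2 / (N + 3)%:R
             * (1 / sin t)
             * (sin ((N + 3)%:R / 2 * t) ^+ 2 / (cos t - cos theta) ^+ 2))
      & (forall j, Pmin`_j = if odd j then Pmax`_j else - Pmax`_j) /\
        (forall z : R[i], ceval Pmin z = - ceval Pmax (- z))].
Proof.
move=> theta q.
pose n := (N + 3)./2.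
have Nn : (N + 3 = 2 * n)%N.
  by rewrite mul2n halfK oddD oddN subn0.
have n3 : (2 < n)%N by lia.
have n0 : n%:R != 0 :> R by rewrite pnatr_eq0; lia.
have thetaE : theta = pi / n%:R by rewrite /theta Nn natrM; field.
have M0 : (N + 3)%:R != 0 :> R by rewrite pnatr_eq0 addn3.
have theta_itv : 0 < theta < pi.
  by rewrite thetaE -[_ / _]mul1r (@grid_itv R n 1)//= ltnW.
have s_gt0 := sin_gt0_pi theta_itv; have s0 := lt0r_neq0 s_gt0.
have Meven : ~~ odd (N + 3) by rewrite oddD oddN.
have Mtheta : (N + 3)%:R * theta = pi *+ 2 by rewrite /theta -mulr_natl; field.
have sM : sin ((N + 3)%:R * theta) = 0 by rewrite Mtheta sin2pi.
have cM : cos ((N + 3)%:R * theta) = 1 by rewrite Mtheta cos2pi.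
pose P := extremal_poly theta N.
have sP : (size P <= N.+1)%N by apply: size_poly.
have P0 : P`_0 = 0 by rewrite coef_poly /= extremal_coef0.
have P1 : P`_1 = 1 by rewrite coef_poly (_ : (1 < N.+1)%N) ?extremal_coef1//; lia.
have P2 : P`_2 = 2 * cos theta by rewrite coef_poly ltnS hN extremal_coef2.
pose T t := complex.Im (ceval P (cis t)).
have TE t : 0 < t < pi -> cos t - cos theta != 0 ->
    T t = sin theta ^+ 2 / (N + 3)%:R * (1 / sin t)
             * (sin ((N + 3)%:R / 2 * t) ^+ 2 / (cos t - cos theta) ^+ 2).
  move=> /sin_gt0_pi /lt0r_neq0 st ct.
  have := @Im_extremal_poly R theta N t s0 Meven sM cM; rewrite -/P -/(T t) => h.
  transitivity ((cos t - cos theta) ^+ 2 * sin t * T t / ((cos t - cos theta) ^+ 2 * sin t)).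
    by field; rewrite st ct.
  rewrite h; move: M0; move: ((N + 3)%:R : R) => m m0.
  by field; rewrite st m0 ct.
have T_cont : continuous T.
  have -> : T = (fun t => sin t * (sine_quotient N P).[cos t]).
    by apply/funext => t; rewrite /T (Im_ceval_sine_quotient _ sP).
  move=> t; apply: cvgM; first exact: continuous_sin.
  by apply: continuous_comp; [exact: continuous_cos|exact: continuous_horner].
have near_theta : \forall t \near theta^', 0 < t < pi /\ cos t - cos theta != 0.
  have h : \forall t \near theta^', 0 < t < pi.
    by apply/nbhs_dnbhs; apply: near_in_itvoo; rewrite in_itv.
  apply: filterS2 (nbhs_dnbhs_neq theta) h => t tt t0; split=> //.
  rewrite subr_eq0; apply: contra_neq tt => /cos_inj; apply.
    by rewrite in_itv /=; move: t0 => /andP[/ltW -> /ltW ->].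
  by rewrite in_itv /=; move: theta_itv => /andP[/ltW -> /ltW ->].
have T_lim : (sin theta ^+ 2 / (N + 3)%:R * (1 / sin t)
   * (sin ((N + 3)%:R / 2 * t) ^+ 2 / (cos t - cos theta) ^+ 2)) @[t --> theta^'] --> T theta.
  apply: cvg_punctured_of_eq; first exact: T_cont.
  by apply: filterS near_theta => t [t0 ct]; rewrite TE.
have cos_theta t : 0 < t < pi -> cos t - cos theta = 0 -> t = theta.
  move=> t0 /eqP; rewrite subr_eq0 => /eqP/cos_inj; apply.
    by rewrite in_itv /=; move: t0 => /andP[/ltW -> /ltW ->].
  by rewrite in_itv /=; move: theta_itv => /andP[/ltW -> /ltW ->].
have formula_ge0 t : 0 < t < pi -> 0 <= sin theta ^+ 2 / (N + 3)%:R * (1 / sin t)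
    * (sin ((N + 3)%:R / 2 * t) ^+ 2 / (cos t - cos theta) ^+ 2).
  move=> /sin_gt0_pi/ltW st; apply: mulr_ge0; last by rewrite divr_ge0 ?sqr_ge0.
  by apply: mulr_ge0; rewrite divr_ge0 ?sqr_ge0.
have T_ge0 t : 0 < t < pi -> 0 <= T t.
  move=> t0; have [ct|ct] := eqVneq (cos t - cos theta) 0; last first.
    by rewrite TE// formula_ge0.
  (* only t = theta is left, where the bound passes to the limit *)
  rewrite (cos_theta t t0 ct); apply: (cvgr_to_ge T_lim).
  by apply: filterS near_theta => u [u0 _]; exact: formula_ge0.
have TP : typically_real_polys N P by apply/typically_real_polysP; split.
have maxP : maximizes_a2 N P.
  by split=> // Q TQ; rewrite P2 thetaE; apply: a2_le TQ.
have uniqP : unique (@maximizes_a2 R N) P.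
  split=> // Q [TQ Qmax]; apply: (a2_max_unique Nn) => //; rewrite -thetaE//.
  apply/eqP; rewrite eq_le -[in X in _ && X]P2 Qmax// andbT.
  by rewrite thetaE; apply: a2_le TQ.
exists P, (odd_reflection P); split=> //.
- split; first exact: maximizes_odd_reflection.
  move=> Q /minimizes_odd_reflection /uniqP.2 ->; exact: odd_reflectionK.
- have key z : ~ (q z = 0 \/ 1 - z ^+ 2 = 0) ->
    ceval P z = z / q z + (4 / (N + 3)%:R * sin theta ^+ 2)%:C
               * (z ^+ 3 / (1 - z ^+ 2)) * ((1 - z ^+ (N + 3)) / q z ^+ 2).
    move=> nS.
    have qz : q z != 0 by apply/eqP => h; apply: nS; left.
    have z1 : 1 - z ^+ 2 != 0 by apply/eqP => h; apply: nS; right.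
    have := @ceval_extremal_poly R theta N z s0 Meven sM cM; rewrite -/(q z) -/P => h.
    move: (_%:C) (ceval P z) (q z) (1 - z ^+ 2) (1 - z ^+ (N + 3)) h qz z1.
    move=> k p A B E h A0 B0.
    apply: (mulfI (_ : A ^+ 2 * B != 0)); first by rewrite mulf_neq0 ?expf_neq0.
    by rewrite h; field; rewrite A0 B0.
  split=> [z _|z _ _]; first exact: key.
  apply: cvg_punctured_of_eq; first exact: continuous_horner_num.
  (* the singular set is the zero set of B, and B takes the value 1 at 0 *)
  pose B : {poly R[i]} := (1 - (2 * (cos theta)%:C) *: 'X + 'X^2) * (1 - 'X^2).
  have BE w : B.[w] = q w * (1 - w ^+ 2) by rewrite /B /q !hornerE; ring.
  have B0 : B != 0.
    apply/negP => /eqP B0; have := BE 0; rewrite B0 horner0 /q expr0n /= => /eqP.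
    by rewrite !(mulr0, mul0r, subr0, addr0) mulr1 eq_sym oner_eq0.
  apply: filterS (near_horner_neq0 z B0) => w; rewrite BE mulf_eq0 negb_or => /andP[qw w1].
  by apply: key => -[/eqP|/eqP]; apply/negP.
- split=> //; split=> t /= t0 ct; first by apply: TE => //; apply/eqP.
  by rewrite (cos_theta t t0 ct).
- by split=> [j|z]; [exact: coef_odd_reflection|exact: ceval_odd_reflection].
Qed.
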